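(* Let $N\in\mathbb{F}_q(t^p)[Y]$ be monic, irreducible and separable over $\mathbb{F}_q(t^p)$, and let $\nu\ge 1$ be an integer. Then there is a ring isomorphism $$\mathcal{D}_{N(\partial^p)^\nu}\simeq \mathcal{D}_{N(\partial^p)}[T]/(T^\nu),$$ where $T$ is a central indeterminate (and under which $T$ corresponds to the class of $N(\partial^p)$).
   Context: Let $p$ be a prime, $q=p^n$. $\mathbb{F}_q(t)\langle\partial\rangle$ is the ring of linear differential operators with coefficients in $\mathbb{F}_q(t)$, multiplication given by $\partial f=f\partial+\frac{df}{dt}$. For $P\in\mathbb{F}_q(t^p)[Y]$, $P(\partial^p)$ is central in $\mathbb{F}_q(t)\langle\partial\rangle$, so $\mathcal{D}_{P(\partial^p)}:=\mathbb{F}_q(t)\langle\partial\rangle/\mathbb{F}_q(t)\langle\partial\rangle P(\partial^p)$ is a quotient by a two-sided ideal and hence a ring. (For $N$ irreducible, $\mathcal{D}_{N(\partial^p)}$ is a central simple algebra of dimension $p^2$ over $C_N=\mathbb{F}_q(t^p)[Y]/(N)$.) *)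

(* Defs.v *)
From HB Require Import structures.
From mathcomp Require Import all_boot all_order all_algebra all_field.
Set Implicit Arguments. Unset Strict Implicit. Unset Printing Implicit Defensive.
Import GRing.Theory.
Local Open Scope ring_scope.
Local Notation "x %:F" := (@FracField.tofrac _ x).

Section DiffOps.
Variable F : finFieldType.

Definition Kt := {fraction {poly F}}.

Definition derK (x : Kt) : Kt :=
  let r := repr x in
  ((\n_r)^`() * \d_r - \n_r * (\d_r)^`())%:F / ((\d_r) ^+ 2)%:F.

(* The field F_q(t^p) is modelled as F_q(s) = {fraction {poly F}}, embedded
   into F_q(t) by s |-> t^p. *)
Definition embp (p : nat) (x : Kt) : Kt :=
  let r := repr x in (\n_r \Po 'X^p)%:F / (\d_r \Po 'X^p)%:F.

(* Differential operators sum_i a_i d^i (coefficients on the left) are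
   represented by {poly Kt}; 'X plays the role of d. *)
(* left multiplication by d :  d * (sum b_j d^j) = sum (b_j d^(j+1) + b_j' d^j) *)
Definition dmulX (Q : {poly Kt}) : {poly Kt} := Q * 'X + map_poly derK Q.

Definition dmul (P Q : {poly Kt}) : {poly Kt} :=
  \sum_(i < size P) P`_i *: iter i dmulX Q.

Definition cen (p : nat) (P : {poly Kt}) : {poly Kt} :=
  map_poly (embp p) P \Po 'X^p.

Definition dequiv (M A B : {poly Kt}) : Prop :=
  exists R : {poly Kt}, A - B = dmul R M.

(* D_M[T]/(T^nu), T central: elements represented by sequences of
   operators (coefficients of T^0, ..., T^(nu-1)); the entries at
   index >= nu are ignored. *)
Definition tadd (nu : nat) (u v : seq {poly Kt}) : seq {poly Kt} :=
  mkseq (fun k => u`_k + v`_k) nu.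
Definition tmul (nu : nat) (u v : seq {poly Kt}) : seq {poly Kt} :=
  mkseq (fun k => \sum_(i < k.+1) dmul u`_i v`_(k - i)) nu.
Definition tone : seq {poly Kt} := [:: 1].
Definition tT : seq {poly Kt} := [:: 0; 1].
Definition tequiv (M : {poly Kt}) (nu : nat) (u v : seq {poly Kt}) : Prop :=
  forall k, (k < nu)%N -> dequiv M u`_k v`_k.

Definition ring_iso_quot (M1 M2 : {poly Kt}) (nu : nat)
  (phi : {poly Kt} -> seq {poly Kt}) : Prop :=
  [/\ forall A B, dequiv M1 A B <-> tequiv M2 nu (phi A) (phi B),
      forall u, exists A, tequiv M2 nu (phi A) u,
      forall A B, tequiv M2 nu (phi (A + B)) (tadd nu (phi A) (phi B)),
      forall A B, tequiv M2 nu (phi (dmul A B)) (tmul nu (phi A) (phi B))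
    & tequiv M2 nu (phi 1) tone].

End DiffOps.

(* Main.v *)
Require Import Defs.
From HB Require Import structures.
From mathcomp Require Import all_boot all_order all_algebra all_field.
From mathcomp Require Import ring.
Import GRing.Theory.
Local Open Scope ring_scope.

Set Implicit Arguments. Unset Strict Implicit.
Local Notation "x %:F" := (@FracField.tofrac _ x).

(** The algebra generated by a field of constants, [t] and [d] is presented by
    [d t - t d = 1], so it has the endomorphisms [d |-> d + b(d^p) / t] for
    every polynomial [b] with constant coefficients, and
    [(d + b / t)^p = d^p + (b^p - b) / t^p].  As [N] is separable, Newton's
    method yields [b] divisible by [N] such that [N^nu] divides
    [N(Y + (b^p - b) / t^p)].  The corresponding endomorphism is the identity
    modulo [N(d^p)] and maps [N(d^p)] into the ideal of [N(d^p)^nu]: it is a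
    section [sigma] of the projection from [D_(N^nu)] to [D_N].  Every operator
    is then uniquely [sum_i N(d^p)^i sigma(A_i)] modulo [N(d^p)^nu] with [A_i]
    in [D_N], and [T^i] is the coordinate of [N(d^p)^i]. *)

(** * Newton's method for the Artin-Schreier shift *)

Lemma comp_poly_taylor2 (R : comNzRingType) (P y h : {poly R}) :
  exists r, P \Po (y + h) = P \Po y + (P^`() \Po y) * h + r * h ^+ 2.
Proof.
elim/poly_ind: P => [|P c [r IH]].
  by exists 0; rewrite deriv0 !comp_poly0; ring.
exists (r * (y + h) + (P^`() \Po y)).
rewrite derivMXaddC !comp_poly_MXaddC IH comp_polyD comp_polyM comp_polyX.
ring.
Qed.

Lemma pchar_exprDp (R : comNzRingType) (p : nat) (hp : p \in [pchar R]) (x y : R) :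
  (x + y) ^+ p = x ^+ p + y ^+ p.
Proof. by rewrite -!(pFrobenius_autE hp) pFrobenius_autD_comm //; exact: mulrC. Qed.

(* Newton iteration: only the linear term of [b ^+ p - b] contributes modulo
   the next power of [N]. *)
Lemma hensel_artin_schreier (K : fieldType) (p : nat) (hp : p \in [pchar K])
    (N : {poly K}) (c : K) (n : nat) :
  separable_poly N -> c != 0 ->
  exists2 b, N %| b & N ^+ n.+1 %| N \Po ('X + c *: (b ^+ p - b)).
Proof.
move=> sepN c0.
have hp' : p \in [pchar {poly K}] by rewrite pchar_poly.
have p_gt1 : (1 < p)%N := prime_gt1 (pcharf_prime hp).
elim: n => [|n [b Nb /dvdpP[e He]]].
  exists 0; rewrite ?dvdp0 // expr0n -[p == 0%N]leqn0 leqNgt (ltnW p_gt1).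
  by rewrite subrr scaler0 addr0 comp_polyXr expr1.
have [[u v] /= Huv] : exists uv, uv.1 * N + uv.2 * N^`() = 1.
  by apply/Bezout_eq1_coprimepP; rewrite separable_poly.unlock in sepN.
set y := 'X + _ in He.
(* As [N] divides [b], the point [y] is congruent to ['X] modulo [N], hence so are the values of the
   derivative of [N] there. *)
have [w Hw] : exists w, N^`() \Po y = N^`() + w * N.
  have [r ->] := comp_poly_taylor2 N^`() 'X (c *: (b ^+ p - b)).
  have [q ->] := dvdpP _ _ Nb.
  rewrite !comp_polyXr -(prednK (ltnW p_gt1)) exprSr.
  set z := _ - _; pose z' := (q * N) ^+ p.-1 * q - q.
  exists (N^`()^`() * (c%:P * z') + r * c%:P * z' * (c%:P * z)).
  rewrite -!mul_polyC /z /z'; ring.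
(* Adding [N ^+ n.+1 * h] to [b] moves [y] by [- N ^+ n.+1 * (v * e)] to leading order; as [v]
   inverts the derivative of [N] modulo [N], this cancels [e]. *)
pose h := c^-1 *: (v * e).
exists (b + N ^+ n.+1 * h); first by rewrite dvdp_add // dvdp_mulr // exprS dvdp_mulr.
(* The Frobenius term: since [2 <= p], the exponent [p (n + 1)] is at least [n + 2], so a spare
   factor [N] splits off next to [g]. *)
set g := c *: (N ^+ n * N ^+ n.+1 ^+ (p - 2) * h ^+ p).
have -> : 'X + c *: ((b + N ^+ n.+1 * h) ^+ p - (b + N ^+ n.+1 * h))
  = y + N ^+ n.+1 * (N * g - v * e).
  rewrite pchar_exprDp // /y /g -!mul_polyC.
  have -> : v * e = c%:P * h by rewrite /h mul_polyC scalerA divff // scale1r.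
  have -> : (N ^+ n.+1 * h) ^+ p = N ^+ n.+1 * (N * N ^+ n * N ^+ n.+1 ^+ (p - 2)) * h ^+ p.
    rewrite exprMn; congr (_ * _).
    by rewrite -[in LHS](subnKC p_gt1) exprD expr2 -[N * N ^+ n]exprS mulrA.
  ring.
have [r ->] := comp_poly_taylor2 N y (N ^+ n.+1 * (N * g - v * e)).
rewrite He Hw; apply/dvdpP.
(* Once [N ^+ n.+1] is factored out, the Bezout identity turns [e] minus the derivative of [N] times
   [v * e] into [e * u * N], which supplies the last factor [N]. *)
exists (e * u + N^`() * g + w * (N * g - v * e) + r * (N * g - v * e) ^+ 2 * N ^+ n).
rewrite exprMn expr2 [N ^+ n.+2]exprS; move: Huv; rewrite exprS => Huv.
transitivity (e * (u * N + v * N^`()) * (N * N ^+ n)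
  + (N^`() + w * N) * (N * N ^+ n * (N * g - v * e))
  + r * (N * N ^+ n * (N * N ^+ n) * (N * g - v * e) ^+ 2)).
  by rewrite Huv mulr1.
ring.
Qed.

(** * Prime-field products and binomial sums *)

Lemma prod_sub_natr (K : fieldType) (p : nat) (hp : p \in [pchar K]) (b : {poly K}) :
  \prod_(i < p) (b - i%:R) = b ^+ p - b.
Proof.
have p_gt1 := prime_gt1 (pcharf_prime hp).
pose s := [seq i%:R : K | i <- iota 0 p].
have szX : size ('X^p - 'X : {poly K}) = p.+1.
  by rewrite size_polyDl size_polyXn // size_polyN size_polyX.
have inj_s : uniq s.
  rewrite map_inj_in_uniq ?iota_uniq // => i j; rewrite !mem_iota !add0n /= => ip jp.
  wlog le_ij : i j ip jp / (i <= j)%N.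
    by move=> wl; case: (leqP i j) => [|/ltnW] ij e; [|symmetry]; apply: wl.
  move/eqP; rewrite eq_sym -subr_eq0 -natrB // -(dvdn_pcharf hp) => /eqP.
  rewrite modn_small ?(leq_ltn_trans (leq_subr _ _)) // => /eqP.
  by rewrite subn_eq0 => le_ji; apply/eqP; rewrite eqn_leq le_ij.
(* The classes of [0, ..., p - 1] are distinct roots of ['X^p - 'X], as many as its degree; [b] is
   substituted for ['X] afterwards. *)
have def : 'X^p - 'X = \prod_(i < p) ('X - (i%:R)%:P) :> {poly K}.
  have rt : all (root ('X^p - 'X)) s.
    apply/allP => _ /mapP[i _ ->]; rewrite rootE !hornerE subr_eq0.
    by rewrite -(pFrobenius_autE hp) pFrobenius_aut_nat.
  rewrite (all_roots_prod_XsubC _ rt) ?uniq_rootsE ?szX ?size_map ?size_iota //.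
  rewrite lead_coefE szX coefB coefXn coefX eqxx gtn_eqF // subr0 scale1r.
  by rewrite big_map -{1}(subn0 p) -/(index_iota 0 p) big_mkord.
have := congr1 (fun P => P \Po b) def.
rewrite rmorph_prod /= comp_polyB comp_Xn_poly comp_polyX => ->.
by apply: eq_bigr => i _; rewrite comp_polyB comp_polyX comp_polyC polyC_natr.
Qed.

(** Each application of [E] raises one of the two indices, so the coefficients count lattice paths
    and obey Pascal's rule. *)
Lemma iter_binomial (V : zmodType) (E : {additive V -> V}) (G : nat -> nat -> V) n :
  (forall j k, E (G j k) = G j.+1 k + G j k.+1) ->
  iter n E (G 0 0) = \sum_(k < n.+1) G (n - k)%N k *+ 'C(n, k).
Proof.
move=> EG; elim: n => [|n IHn]; first by rewrite big_ord1.
rewrite iterS {}IHn raddf_sum /=.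
under eq_bigr => k _ do rewrite raddfMn EG mulrnDl -subSn ?leq_ord //.
rewrite big_split /= big_ord_recl [X in _ + X]big_ord_recr /= [RHS]big_ord_recl.
rewrite [X in _ = _ + X]big_ord_recr /= !bin0 !binn !subnn.
rewrite -!addrA; congr (_ + _); rewrite addrA -big_split; congr (_ + _).
by apply: eq_bigr => i _ /=; rewrite /bump /= add1n subSS binS mulrnDr ?subnSK // addrC.
Qed.

(** The interior binomial coefficients vanish in characteristic [p]. This plays the part of
    Frobenius additivity for a sum of two commuting maps. *)
Lemma iter_pchar (R : nzRingType) (V : lmodType R) (E : {additive V -> V})
    (G : nat -> nat -> V) p :
  p \in [pchar R] ->
  (forall j k, E (G j k) = G j.+1 k + G j k.+1) ->
  iter p E (G 0 0) = G p 0 + G 0 p.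
Proof.
move=> hp EG; rewrite iter_binomial //.
have := prime_gt0 (pcharf_prime hp); case: p hp => // q hq _.
rewrite big_ord_recr /= subnn binn big_ord_recl subn0 bin0.
rewrite big1 ?addr0 // => i _.
by rewrite -scaler_nat (bin_lt_pcharf_0 hq) ?scale0r //= /bump /= add1n ltnS ltn_ord.
Qed.

(** Both sides run over the pairs with [i + j < n], grouped by their sum or by their first entry. *)
Lemma sum_convolution (V : nmodType) (G : nat -> nat -> V) n :
  \sum_(k < n) \sum_(i < k.+1) G i (k - i)%N =
  \sum_(i < n) \sum_(0 <= j < n - i) G i j.
Proof.
under eq_bigr => k _ do rewrite (big_ord_widen n (fun i => G i (k - i)%N)) //.
rewrite (exchange_big_dep xpredT) //=; apply: eq_bigr => i _.
under [LHS]eq_bigl => k do rewrite ltnS.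
rewrite -(big_mkord (fun k => i <= k)%N (fun k => G i (k - i)%N)).
rewrite -(@big_nat_widenl _ _ _ i 0 n xpredT) // -{1}[i : nat]add0n big_addn.
by apply: eq_bigr => j _; rewrite addnK.
Qed.

Lemma derivation1 (R : nzRingType) (d : {additive R -> R}) :
  (forall x y, d (x * y) = d x * y + x * d y) -> d 1 = 0.
Proof. by move=> dM; apply: (addIr (d 1)); rewrite add0r -{3}[1]mulr1 dM mulr1 mul1r. Qed.

Lemma derivation_exp (R : comNzRingType) (d : {additive R -> R}) x m :
  (forall x y, d (x * y) = d x * y + x * d y) ->
  d (x ^+ m) = x ^+ m.-1 * d x *+ m.
Proof.
move=> dM; elim: m => [|m IH]; first by rewrite expr0 derivation1.
rewrite exprS dM IH mulrnAr mulrA [RHS]mulrS.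
by case: m {IH} => [|m]; rewrite ?expr0 ?mul1r ?mulr1 ?mulr0n // -exprS mulrC.
Qed.

(** * Operators over a field with a derivation *)

(* For [K = Kt F], [d = derK] and [emb = embp p], the operations [opmulX],
   [opmul] and [opcen] are convertible to [dmulX], [dmul] and [cen p].  As
   there, [emb] identifies [K] with the field of constants, taking [s] to
   [t^p]. *)
Section DifferentialOperators.
Variables (K : fieldType) (d : {additive K -> K}) (emb : {rmorphism K -> K}).
Variable p : nat.
Implicit Types (c : K) (P Q R b e : {poly K}).

Definition opmulX Q : {poly K} := Q * 'X + map_poly d Q.

Definition opmul P Q : {poly K} := \sum_(i < size P) P`_i *: iter i opmulX Q.

Definition opcen P : {poly K} := map_poly emb P \Po 'X^p.

Hypothesis dM : forall x y, d (x * y) = d x * y + x * d y.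
Hypothesis hp : p \in [pchar K].
Hypothesis d_emb : forall x, d (emb x) = 0.
Hypothesis iter_d_pchar : forall x, iter p d x = 0.
Variables (s t : K).
Hypothesis t0 : t != 0.
Hypothesis dt : d t = 1.
Hypothesis emb_s : emb s = t ^+ p.

Let p_gt0 : (0 < p)%N := prime_gt0 (pcharf_prime hp).

Let d1 : d 1 = 0 := derivation1 dM.

(** * The coefficientwise derivation and the central operators *)

Definition polyder Q : {poly K} := map_poly d Q.

Lemma coef_polyder Q i : (polyder Q)`_i = d Q`_i.
Proof. by rewrite coef_map_id0 // raddf0. Qed.

Lemma polyder_zmod : zmod_morphism polyder.
Proof. by move=> P Q; apply/polyP => i; rewrite !(coefB, coef_polyder) raddfB. Qed.

HB.instance Definition _ :=
  GRing.isZmodMorphism.Build {poly K} {poly K} polyder polyder_zmod.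

Lemma polyderM P Q : polyder (P * Q) = polyder P * Q + P * polyder Q.
Proof.
apply/polyP => i; rewrite coefD !coefM coef_polyder coefM raddf_sum -big_split.
by apply: eq_bigr => j _ /=; rewrite !coef_polyder dM.
Qed.

Lemma polyderZ c Q : polyder (c *: Q) = c *: polyder Q + d c *: Q.
Proof.
by apply/polyP => i; rewrite coefD !(coefZ, coef_polyder) dM addrC.
Qed.

Lemma polyderXn n : polyder 'X^n = 0.
Proof.
apply/polyP => i; rewrite coef_polyder coefXn coef0.
by case: eqP => _; rewrite ?d1 ?raddf0.
Qed.

Lemma iter_polyder_pchar Q : iter p polyder Q = 0.
Proof.
apply/polyP => i; rewrite coef0 -[RHS](iter_d_pchar Q`_i).
by elim: {1 2}p => //= k IH; rewrite coef_polyder IH.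
Qed.

Lemma opcen_zmod : zmod_morphism opcen.
Proof. by move=> P Q; rewrite /opcen rmorphB comp_polyB. Qed.

Lemma opcen_monoid : monoid_morphism opcen.
Proof.
split; first by rewrite /opcen rmorph1 -polyC1 comp_polyC.
by move=> P Q; rewrite /opcen rmorphM comp_polyM.
Qed.

HB.instance Definition _ :=
  GRing.isZmodMorphism.Build {poly K} {poly K} opcen opcen_zmod.
HB.instance Definition _ :=
  GRing.isMonoidMorphism.Build {poly K} {poly K} opcen opcen_monoid.

Lemma opcenX : opcen 'X = 'X^p :> {poly K}.
Proof. by rewrite /opcen map_polyX comp_polyX. Qed.

Lemma opcenC c : opcen c%:P = (emb c)%:P :> {poly K}.
Proof. by rewrite /opcen map_polyC comp_polyC. Qed.

Lemma opcen_comp P Q : opcen (P \Po Q) = map_poly emb P \Po opcen Q.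
Proof. by rewrite /opcen map_comp_poly comp_polyA. Qed.

Lemma opcen_eq0 P : (opcen P == 0) = (P == 0).
Proof. by rewrite /opcen comp_poly_eq0 ?map_poly_eq0 // size_polyXn ltnS. Qed.

Lemma opcen_dvdp P Q : P %| Q -> opcen P %| opcen Q.
Proof. by case/dvdpP => R ->; rewrite rmorphM dvdp_mull. Qed.

Lemma polyder_opcen P : polyder (opcen P) = 0.
Proof.
elim/poly_ind: P => [|P c IH]; first by rewrite !raddf0.
rewrite rmorphD rmorphM /= opcenX opcenC raddfD /= polyderM IH polyderXn mul0r mulr0.
apply/polyP => i; rewrite !(coefD, coef0) coef_polyder coefC.
by case: ifP; rewrite ?d_emb ?raddf0 !addr0.
Qed.

Lemma opmulX_zmod : zmod_morphism opmulX.
Proof. by move=> P Q; rewrite /opmulX -!/(polyder _) raddfB mulrBl opprD addrACA. Qed.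

HB.instance Definition _ :=
  GRing.isZmodMorphism.Build {poly K} {poly K} opmulX opmulX_zmod.

Lemma opmulXZ c Q : opmulX (c *: Q) = c *: opmulX Q + d c *: Q.
Proof. by rewrite /opmulX -/(polyder _) polyderZ scalerDr scalerAl addrA. Qed.

Lemma opmulX_opcen b Q : opmulX (opcen b * Q) = opcen b * opmulX Q.
Proof. by rewrite /opmulX -/(polyder _) polyderM polyder_opcen mul0r add0r mulrDr mulrA. Qed.

(* The action of operators on [V] in which the derivation acts as [E]. *)
Definition dact (V : lmodType K) (E : V -> V) (P : {poly K}) (v : V) : V :=
  \sum_(i < size P) P`_i *: iter i E v.

(** * Modules over the ring of operators *)

Section Action.
Variables (V : lmodType K) (E : {additive V -> V}).

Lemma dact_wide n P v :
  (size P <= n)%N -> dact E P v = \sum_(i < n) P`_i *: iter i E v.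
Proof.
move=> le_n; rewrite /dact (big_ord_widen n (fun i => P`_i *: iter i E v)) // big_mkcond.
by apply: eq_bigr => i _; case: ltnP => // /(nth_default _) ->; rewrite scale0r.
Qed.

Lemma dactD P Q v : dact E (P + Q) v = dact E P v + dact E Q v.
Proof.
pose n := maxn (size P) (size Q).
rewrite !(@dact_wide n) ?leq_maxl ?leq_maxr ?size_polyD // -big_split.
by apply: eq_bigr => i _; rewrite coefD scalerDl.
Qed.

Lemma dactZ c P v : dact E (c *: P) v = c *: dact E P v.
Proof.
rewrite (@dact_wide (size P)) ?size_scale_leq // scaler_sumr.
by apply: eq_bigr => i _; rewrite coefZ scalerA.
Qed.

Lemma dact0 v : dact E 0 v = 0.
Proof. by rewrite /dact size_poly0 big_ord0. Qed.

Lemma dactB P Q v : dact E (P - Q) v = dact E P v - dact E Q v.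
Proof. by apply: (addIr (dact E Q v)); rewrite subrK -dactD subrK. Qed.

Lemma dact_suml I (r : seq I) (P : pred I) G v :
  dact E (\sum_(i <- r | P i) G i) v = \sum_(i <- r | P i) dact E (G i) v.
Proof. by apply: (big_morph (dact E ^~ v)) => [A B|]; rewrite ?dactD ?dact0. Qed.

Lemma dactC c v : dact E c%:P v = c *: v.
Proof. by rewrite (@dact_wide 1) ?size_polyC_leq1 // big_ord1 coefC. Qed.

Lemma dact1 v : dact E 1 v = v.
Proof. by rewrite -polyC1 dactC scale1r. Qed.

Lemma dactMXn P n v : dact E (P * 'X^n) v = dact E P (iter n E v).
Proof.
rewrite (@dact_wide (n + size P)); last first.
  by rewrite (leq_trans (size_polyMleq _ _)) // size_polyXn addnS addnC.
rewrite big_split_ord /= big1 ?add0r => [|i _]; last by rewrite coefMXn ltn_ord scale0r.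
apply: eq_bigr => i _; rewrite coefMXn ltnNge leq_addr addKn /= addnC.
by rewrite iterD.
Qed.

Lemma iter_raddfD n u v : iter n E (u + v) = iter n E u + iter n E v.
Proof. by elim: n => //= n ->; rewrite raddfD. Qed.

Lemma dact_addr P u v : dact E P (u + v) = dact E P u + dact E P v.
Proof.
rewrite -big_split; apply: eq_bigr => i _.
by rewrite iter_raddfD scalerDr.
Qed.

Hypothesis EZ : forall c v, E (c *: v) = c *: E v + d c *: v.

Lemma dact_opmulX P v : dact E (opmulX P) v = E (dact E P v).
Proof.
rewrite /opmulX -['X]expr1 dactD dactMXn (@dact_wide (size P) (map_poly _ _)) ?size_poly //.
rewrite /dact raddf_sum -big_split; apply: eq_bigr => i _ /=.
by rewrite EZ coef_polyder -iterSr.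
Qed.

Lemma dact_opmul P Q v : dact E (opmul P Q) v = dact E P (dact E Q v).
Proof.
rewrite /opmul dact_suml; apply: eq_bigr => i _; rewrite dactZ; congr (_ *: _).
by elim: (i : nat) => //= k IH; rewrite dact_opmulX IH.
Qed.

End Action.

(** Applied below to [opmulX], where [Y] is ['X^p], and to [twist b], where [Y] is
    [opcen (center_shift b)]. *)
Lemma dact_opcen (E : {additive {poly K} -> {poly K}}) Y P Q :
  (forall Q, iter p E Q = Y * Q) ->
  dact E (opcen P) Q = (map_poly emb P \Po Y) * Q.
Proof.
move=> EY; elim/poly_ind: P Q => [|P c IH] Q.
  by rewrite !rmorph0 dact0 mul0r.
rewrite rmorphD rmorphM /= opcenX opcenC dactD dactMXn dactC EY IH.
rewrite rmorphD rmorphM /= map_polyX map_polyC comp_poly_MXaddC.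
by rewrite mulrDl mulrA mul_polyC.
Qed.

(** * Connections and their [p]-th powers *)

Definition connection b Q : {poly K} := polyder Q + t^-1 *: (opcen b * Q).

Lemma connection_zmod b : zmod_morphism (connection b).
Proof. by move=> P Q; rewrite /connection raddfB mulrBr scalerBr opprD addrACA. Qed.

HB.instance Definition _ b :=
  GRing.isZmodMorphism.Build {poly K} {poly K} (connection b) (connection_zmod b).

(** Left multiplication by the operator [d + b(d^p) / t]. *)
Definition twist b Q : {poly K} := opmulX Q + t^-1 *: (opcen b * Q).

Lemma twistE b Q : twist b Q = 'X * Q + connection b Q.
Proof. by rewrite /twist /opmulX -addrA mulrC. Qed.

Lemma twist_zmod b : zmod_morphism (twist b).
Proof. by move=> P Q; rewrite !twistE raddfB mulrBr [in RHS]opprD addrACA. Qed.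

HB.instance Definition _ b :=
  GRing.isZmodMorphism.Build {poly K} {poly K} (twist b) (twist_zmod b).

Lemma twistZ b c Q : twist b (c *: Q) = c *: twist b Q + d c *: Q.
Proof.
have -> : twist b (c *: Q) = opmulX (c *: Q) + c *: (t^-1 *: (opcen b * Q)).
  by rewrite /twist -scalerAr !scalerA [c * _]mulrC.
by rewrite opmulXZ [in RHS]scalerDr; exact: addrAC.
Qed.

Lemma derivation_expV n : d (t^-1 ^+ n) = - (n%:R * t^-1 ^+ n.+1).
Proof.
have dV : d t^-1 = - t^-1 ^+ 2.
  apply: (mulfI t0); apply: (addrI (d t * t^-1)).
  rewrite -dM divff // d1 dt mul1r.
  by rewrite mulrN expr2 mulrA divff // mul1r subrr.
rewrite (derivation_exp _ _ dM) dV mulrN mulNrn mulr_natl; congr (- _).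
by case: n => [|n] /=; rewrite ?mulr0n // -exprD addn2.
Qed.

Lemma connection_opcen b c e Q :
  connection b (c *: opcen e * Q) =
  (d c *: opcen e + (t^-1 * c) *: opcen (b * e)) * Q + c *: opcen e * polyder Q.
Proof.
have E : t^-1 *: (opcen b * (c *: opcen e * Q)) = (t^-1 * c) *: opcen (b * e) * Q.
  by rewrite rmorphM -scalerAl -scalerAr scalerA mulrA scalerAl.
rewrite {1}/connection polyderM polyderZ polyder_opcen scaler0 add0r E [in RHS]mulrDl.
exact: addrAC.
Qed.

(* Applied [j] times to [1], the connection gives [b (b - 1) ... (b - j + 1) / t^j]. *)
Lemma iter_connection b Q :
  iter p (connection b) Q = t^-1 ^+ p *: opcen (b ^+ p - b) * Q.
Proof.
pose w j : {poly K} := t^-1 ^+ j *: opcen (\prod_(i < j) (b - i%:R)).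
(* By Leibniz, the connection either differentiates [Z] or raises [j]; differentiating [t^-1 ^+ j]
   supplies the [- j] of the new factor [b - j]. *)
have eS j (Z : {poly K}) : connection b (w j * Z) = w j.+1 * Z + w j * polyder Z.
  rewrite connection_opcen derivation_expV; congr (_ * _ + _).
  rewrite /w big_ord_recr /=; set B := \prod_(i < j) _.
  have -> : opcen (B * (b - j%:R)) = opcen (b * B) - (j%:R : K) *: opcen B.
    by rewrite mulrBr mulr_natr rmorphB rmorphMn /= scaler_nat [b * B]mulrC.
  rewrite -exprS scaleNr [in RHS]scalerBr scalerA [_ * j%:R]mulrC.
  exact: addrC.
have -> : iter p (connection b) Q = iter p (connection b) (w 0 * iter 0 polyder Q).
  by rewrite /w big_ord0 rmorph1 expr0 scale1r mul1r.
rewrite (@iter_pchar _ _ _ (fun j k => w j * iter k polyder Q) _ hp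
  (fun j k => eS j (iter k polyder Q))).
by rewrite iter_polyder_pchar mulr0 addr0 /w (prod_sub_natr hp).
Qed.

(** The image of the central variable [d^p] under [d |-> d + b(d^p) / t], with [s] standing for
    [t^p]. *)
Definition center_shift b : {poly K} := 'X + s^-1 *: (b ^+ p - b).

(** Multiplication by ['X] commutes with the connection, so the [p]-th power of their sum is the sum
    of their [p]-th powers. *)
Lemma iter_twist b Q : iter p (twist b) Q = opcen (center_shift b) * Q.
Proof.
have S j k : twist b ('X^j * iter k (connection b) Q) =
    'X^(j.+1) * iter k (connection b) Q + 'X^j * iter k.+1 (connection b) Q.
  rewrite twistE exprS mulrA; congr (_ + _).
  rewrite {1}/connection polyderM polyderXn mul0r add0r [in RHS]mulrDr; congr (_ + _).
  by rewrite -[RHS]scalerAr [in RHS]mulrCA.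
have -> : iter p (twist b) Q = iter p (twist b) ('X^0 * iter 0 (connection b) Q).
  by rewrite expr0 mul1r.
rewrite (@iter_pchar _ _ _ (fun j k => 'X^j * iter k (connection b) Q) _ hp S).
rewrite expr0 mul1r iter_connection -mulrDl; congr (_ * _).
rewrite [in RHS]rmorphD /= opcenX -[in RHS]mul_polyC [in RHS]rmorphM /= opcenC.
by rewrite fmorphV emb_s mul_polyC exprVn.
Qed.

(** * Multiplication and congruences by central operators *)

Lemma opmul_opcen e Q : opmul (opcen e) Q = opcen e * Q.
Proof.
apply: (@dact_opcen opmulX) => {}Q.
(* For [b = 0] the twist is [opmulX], whose [p]-th iterate is thus multiplication by ['X^p]. *)
have := iter_twist 0 Q; rewrite /center_shift expr0n -[p == 0%N]leqn0 leqNgt p_gt0 subrr.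
rewrite scaler0 addr0 opcenX => <-; apply: eq_iter => A.
by rewrite /twist raddf0 mul0r scaler0 addr0.
Qed.

Lemma opmulA P Q R : opmul (opmul P Q) R = opmul P (opmul Q R).
Proof. by apply: dact_opmul => c v; apply: opmulXZ. Qed.

Lemma opmul_opcenl e P Q : opmul (opcen e * P) Q = opcen e * opmul P Q.
Proof. by rewrite -opmul_opcen opmulA opmul_opcen. Qed.

Lemma dact_opcenr (E : {poly K} -> {poly K}) e P Q :
  (forall Q, E (opcen e * Q) = opcen e * E Q) ->
  dact E P (opcen e * Q) = opcen e * dact E P Q.
Proof.
move=> Ed; rewrite mulr_sumr; apply: eq_bigr => i _; rewrite -scalerAr.
by congr (_ *: _); elim: (i : nat) => //= k ->.
Qed.

Lemma opmul_opcenr e P Q : opmul P (opcen e * Q) = opcen e * opmul P Q.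
Proof. by apply: dact_opcenr; apply: opmulX_opcen. Qed.

Lemma opmul1r P : opmul P 1 = P.
Proof.
rewrite -[RHS]coefK poly_def; apply: eq_bigr => i _; congr (_ *: _).
elim: (i : nat) => //= k ->; rewrite /opmulX -/(polyder _) polyderXn addr0.
by rewrite exprSr.
Qed.

(** The left ideal of a central operator is its ideal in the commutative ring [{poly K}], so
    congruences of operators become polynomial divisibility. *)
Lemma opmul_opcen_dvdp e P : reflect (exists R, P = opmul R (opcen e)) (opcen e %| P).
Proof.
have dmd R : opmul R (opcen e) = R * opcen e.
  by rewrite -[opcen e]mulr1 opmul_opcenr opmul1r mulr1 mulrC.
by apply: (iffP (dvdpP _ _)) => -[R ->]; exists R; rewrite dmd.
Qed.

Lemma opmulBl P Q R : opmul (P - Q) R = opmul P R - opmul Q R.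
Proof. exact: (dactB opmulX). Qed.

Lemma opmulDr P Q R : opmul P (Q + R) = opmul P Q + opmul P R.
Proof. exact: (dact_addr opmulX). Qed.

Lemma opmulBr P Q R : opmul P (Q - R) = opmul P Q - opmul P R.
Proof. by apply: (addIr (opmul P R)); rewrite subrK -opmulDr subrK. Qed.

Lemma opmul_suml I (r : seq I) (S : pred I) (G : I -> {poly K}) P :
  opmul (\sum_(i <- r | S i) G i) P = \sum_(i <- r | S i) opmul (G i) P.
Proof. exact: (dact_suml opmulX). Qed.

Lemma opmul_sumr I (r : seq I) (S : pred I) (G : I -> {poly K}) P :
  opmul P (\sum_(i <- r | S i) G i) = \sum_(i <- r | S i) opmul P (G i).
Proof.
apply: (big_morph (opmul P)) => [A B|]; first exact: opmulDr.
by move: (opmulBr P 0 0); rewrite !subrr.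
Qed.

Lemma opmulXl P Q : opmul (opmulX P) Q = opmulX (opmul P Q).
Proof. exact: (dact_opmulX opmulXZ). Qed.

(** * The endomorphisms [shift b] *)

Lemma twist_opmul b P Q : twist b (opmul P Q) = opmul (twist b P) Q.
Proof.
have -> : opmul (twist b P) Q =
    opmul (opmulX P) Q + t^-1 *: opmul (opcen b * P) Q.
  by rewrite /twist [LHS](dactD opmulX) (dactZ opmulX).
by rewrite opmulXl opmul_opcenl.
Qed.

(* The ring endomorphism of the algebra of operators fixing [K] and sending the
   derivation ['X] to ['X + b(d^p) / t]. *)
Definition shift b P : {poly K} := dact (twist b) P 1.

Lemma dact_twist b P Q : dact (twist b) P Q = opmul (shift b P) Q.
Proof.
rewrite /shift opmul_suml; apply: eq_bigr => i _.
rewrite [RHS](dactZ opmulX); congr (_ *: _).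
elim: (i : nat) => [|k IH] /=; first exact/esym/(dact1 opmulX).
by rewrite IH twist_opmul.
Qed.

(** [twist b] obeys the same Leibniz rule as [opmulX], so [dact (twist b)] is a module action; by
    [dact_twist] it is left multiplication by the shifted operator. *)
Lemma shift_opmul b P Q : shift b (opmul P Q) = opmul (shift b P) (shift b Q).
Proof.
by rewrite -dact_twist; exact: (dact_opmul (@twistZ b)).
Qed.

Lemma shiftB b : zmod_morphism (shift b).
Proof. by move=> P Q; apply: (dactB (twist b)). Qed.

HB.instance Definition _ b :=
  GRing.isZmodMorphism.Build {poly K} {poly K} (shift b) (shiftB b).

Lemma shift1 b : shift b 1 = 1.
Proof. exact: (dact1 (twist b)). Qed.

Lemma shift_opcenM b e P :
  shift b (opcen e * P) = opcen (e \Po center_shift b) * shift b P.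
Proof.
rewrite -opmul_opcen shift_opmul -dact_twist opcen_comp.
by apply: dact_opcen => Q; apply: iter_twist.
Qed.

(** [twist b] and [opmulX] differ by multiples of [opcen b], and [opmulX] preserves the multiples of
    [opcen e]. *)
Lemma shift_sub_dvdp e b P : e %| b -> opcen e %| shift b P - P.
Proof.
move=> /opcen_dvdp eb; rewrite -{2}[P]opmul1r /opmul /shift /dact -sumrB.
apply: (big_ind (fun A => opcen e %| A)) => [|A B|i _]; [exact: dvdp0 | exact: dvdp_add |].
rewrite -scalerBr -mul_polyC dvdp_mull //.
elim: (i : nat) => [|k IH] /=; first by rewrite subrr dvdp0.
rewrite {1}/twist addrAC -raddfB dvdp_add //; last first.
  by rewrite -mul_polyC dvdp_mull // dvdp_mulr.
by case/dvdpP: IH => R /= ->; rewrite mulrC opmulX_opcen dvdp_mulr.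
Qed.

(** * Expansions in powers of [M] with digits in the image of [sigma] *)

Section Lifting.
Variables (N b : {poly K}) (nu : nat).
Hypothesis N0 : N != 0.
Hypothesis Nb : N %| b.
Hypothesis N_shift : N ^+ nu %| N \Po center_shift b.

Let M := opcen N.
Let sigma := shift b.

Let M0 : M != 0. Proof. by rewrite opcen_eq0. Qed.

Let MX n : M ^+ n = opcen (N ^+ n). Proof. by rewrite rmorphXn. Qed.

(** By [N_shift], [sigma] sends [M] into the ideal of [M ^+ nu], so it is defined on the quotient by
    [M]. *)
Lemma dvdp_shift P : M %| P -> M ^+ nu %| sigma P.
Proof.
case/dvdpP => Q ->; rewrite mulrC /sigma shift_opcenM MX dvdp_mulr //.
exact: opcen_dvdp.
Qed.

Lemma dvdp_shift_iff P : (M %| sigma P) = (M %| P).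
Proof. by rewrite -(subrK P (sigma P)) dvdp_addr // shift_sub_dvdp. Qed.

(** [P] and its lowest digit [sigma P] agree modulo [M], so this division is exact and carries the
    higher digits. *)
Definition digit_rest P := (P - sigma P) %/ M.

Lemma digit_restE P : P = sigma P + M * digit_rest P.
Proof.
by rewrite /digit_rest mulrC divpK ?subrKC // -opprB dvdpNr shift_sub_dvdp.
Qed.

(* The map [D_M[T]/(T^nu) -> D_(M^nu)] extending [sigma] by [T |-> M]; its
   inverse is read off from the iterates of [digit_rest]. *)
Definition recompose (u : nat -> {poly K}) := \sum_(i < nu) M ^+ i * sigma (u i).

Lemma recompose_digits P :
  M ^+ nu %| P - recompose (fun i => iter i digit_rest P).
Proof.
rewrite /recompose.
suff E m : P - \sum_(i < m) M ^+ i * sigma (iter i digit_rest P)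
    = M ^+ m * iter m digit_rest P by rewrite E dvdp_mulIl.
elim: m => [|m IHm]; first by rewrite big_ord0 subr0 mul1r.
rewrite big_ord_recr opprD addrA IHm /= exprSr -mulrA -mulrBr; congr (_ * _).
by rewrite {1}[iter m _ _]digit_restE addrC addKr.
Qed.

(** Uniqueness of digits. Modulo [M] only the lowest term remains, so [M] divides its digit; by
    [dvdp_shift] that term vanishes modulo [M ^+ nu], and the rest can be divided by [M]. *)
Lemma recompose_dvdp u :
  M ^+ nu %| recompose u <-> (forall i, (i < nu)%N -> M %| u i).
Proof.
split=> [|Mu]; last first.
  apply: (big_ind (fun A => M ^+ nu %| A)) => [|A B|i _];
    [exact: dvdp0 | exact: dvdp_add |].
  by rewrite dvdp_mull // dvdp_shift // Mu.
(* Only the length [n] decreases in the induction; [nu] stays fixed, so [dvdp_shift] still covers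
   the modulus [M ^+ n]. *)
suff gen n (v : nat -> {poly K}) : (n <= nu)%N ->
  M ^+ n %| \sum_(i < n) M ^+ i * sigma (v i) ->
  forall i, (i < n)%N -> M %| v i by exact: gen.
elim: n v => // n IH v lt_n; rewrite big_ord_recl mul1r.
have -> : \sum_(i < n) M ^+ lift ord0 i * sigma (v (lift ord0 i))
    = M * \sum_(i < n) M ^+ i * sigma (v i.+1).
  by rewrite mulr_sumr; apply: eq_bigr => i _; rewrite exprS -mulrA.
set S := (\sum_(i < n) _) => dvS; have Mv0 : M %| v 0%N.
  rewrite -dvdp_shift_iff -(dvdp_addl _ (dvdp_mulIl M S)).
  by apply: dvdp_trans dvS; rewrite exprS dvdp_mulr.
have dv0 : M ^+ n.+1 %| sigma (v 0%N).
  by apply: dvdp_trans (dvdp_shift Mv0); rewrite dvdp_exp2l.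
move: dvS; rewrite dvdp_addr // exprS dvdp_mul2l // => dvS.
have Mv := IH (fun i => v i.+1) (ltnW lt_n) dvS.
by case.
Qed.

Lemma recomposeB u v :
  recompose u - recompose v = recompose (fun i => u i - v i).
Proof.
rewrite /recompose -sumrB; apply: eq_bigr => i _.
by rewrite /sigma raddfB mulrBr.
Qed.

Lemma recomposeD u v :
  recompose (fun i => u i + v i) = recompose u + recompose v.
Proof.
rewrite /recompose -big_split; apply: eq_bigr => i _.
by rewrite /sigma raddfD mulrDr.
Qed.

Lemma recompose_delta n :
  recompose (fun k => (k == n)%:R) = if (n < nu)%N then M ^+ n else 0.
Proof.
case: ltnP => [lt_n|le_n].
  rewrite /recompose (bigD1 (Ordinal lt_n)) //= eqxx /sigma shift1 mulr1.
  rewrite big1 ?addr0 // => i; rewrite -val_eqE /= => /negPf ->.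
  by rewrite raddf0 mulr0.
rewrite /recompose big1 // => i _.
by rewrite ltn_eqF ?(leq_trans (ltn_ord i)) // /sigma raddf0 mulr0.
Qed.

(** As [M] is central and [sigma] multiplicative, both expressions are sums of the [G i j]; they
    differ by terms with [nu <= i + j], all divisible by [M ^+ nu]. *)
Lemma recomposeM (u v : nat -> {poly K}) :
  M ^+ nu %| recompose (fun k => \sum_(i < k.+1) opmul (u i) (v (k - i)%N))
    - opmul (recompose u) (recompose v).
Proof.
pose G i j : {poly K} := M ^+ (i + j) * opmul (sigma (u i)) (sigma (v j)).
have -> : recompose (fun k => \sum_(i < k.+1) opmul (u i) (v (k - i)%N))
    = \sum_(k < nu) \sum_(i < k.+1) G i (k - i)%N.
  apply: eq_bigr => k _; rewrite /sigma raddf_sum mulr_sumr.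
  by apply: eq_bigr => i _; rewrite /G subnKC ?leq_ord //= shift_opmul.
have -> : opmul (recompose u) (recompose v) = \sum_(i < nu) \sum_(0 <= j < nu) G i j.
  rewrite opmul_suml; apply: eq_bigr => i _; rewrite opmul_sumr big_mkord.
  apply: eq_bigr => j _; rewrite !MX opmul_opcenl opmul_opcenr mulrA -rmorphM -exprD.
  by rewrite /G MX.
rewrite sum_convolution -opprB dvdpNr -sumrB.
apply: (big_ind (fun A => M ^+ nu %| A)) => [|A B|i _];
  [exact: dvdp0 | exact: dvdp_add |].
rewrite (big_cat_nat (n := (nu - i)%N)) ?leq_subr //= addrAC subrr add0r big_nat.
apply: (big_ind (fun A => M ^+ nu %| A)) => [|A B|j /andP[le_j _]];
  [exact: dvdp0 | exact: dvdp_add |].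
by rewrite /G dvdp_mulr // dvdp_exp2l // addnC -leq_subLR leq_subCl.
Qed.

(** [M ^+ nu] is central, so its ideal is two-sided and the product descends to the quotient. *)
Lemma opmul_dvdp P Q P' Q' :
  M ^+ nu %| P - P' -> M ^+ nu %| Q - Q' -> M ^+ nu %| opmul P Q - opmul P' Q'.
Proof.
move=> dP dQ; rewrite -(subrK (opmul P' Q) (opmul P Q)) -addrA.
rewrite -opmulBl -opmulBr MX; move: dP dQ; rewrite MX.
case/dvdpP=> A ->; case/dvdpP=> B ->; rewrite ![_ * opcen _]mulrC.
by rewrite opmul_opcenl opmul_opcenr dvdp_add // dvdp_mulr.
Qed.

End Lifting.

(** The ring laws are checked on the inverse map [rec], which has an explicit formula, and carried
    over to [phi] by uniqueness of digits ([key]). *)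
Theorem opmul_truncated_iso N nu :
  separable_poly N -> (0 < nu)%N ->
  let M := opcen N in
  let eqv (u v : nat -> {poly K}) := forall k, (k < nu)%N -> M %| u k - v k in
  exists phi : {poly K} -> nat -> {poly K},
  [/\ forall P Q, M ^+ nu %| P - Q <-> eqv (phi P) (phi Q),
      forall u, exists P, eqv (phi P) u,
      forall P Q, eqv (phi (P + Q)) (fun k => phi P k + phi Q k),
      forall P Q, eqv (phi (opmul P Q))
        (fun k => \sum_(i < k.+1) opmul (phi P i) (phi Q (k - i)%N))
    & eqv (phi 1) (fun k => (k == 0%N)%:R) /\ eqv (phi M) (fun k => (k == 1%N)%:R)].
Proof.
move=> sepN nu0 M eqv.
have N0 := separable_poly_neq0 sepN.
have sV0 : s^-1 != 0 by rewrite invr_eq0 -(fmorph_eq0 emb) emb_s expf_neq0.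
(* Newton's method yields the exponent [n.+1], hence [nu.-1]; the scalar is [s^-1] as in
   [center_shift]. *)
have [b Nb Hb] := hensel_artin_schreier hp nu.-1 sepN sV0.
rewrite (prednK nu0) -/(center_shift b) in Hb.
pose rec := recompose N b nu.
pose phi P i := iter i (digit_rest N b) P.
have recP u v : eqv u v <-> M ^+ nu %| rec u - rec v.
  by rewrite /rec recomposeB (recompose_dvdp N0 Nb Hb).
have recK P : M ^+ nu %| P - rec (phi P) by apply: recompose_digits.
have key P u : M ^+ nu %| P - rec u -> eqv (phi P) u.
  move=> dP; rewrite recP -[rec (phi P)](subrK P) -addrA dvdp_add //.
  by rewrite -opprB dvdpNr.
exists phi; split.
- move=> P Q; split=> [dPQ|/recP dPQ].
    by apply: key; rewrite -(subrK Q P) -addrA dvdp_add.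
  rewrite -(subrK (rec (phi P)) P) -addrA dvdp_add //.
  rewrite -(subrK (rec (phi Q)) (rec (phi P))) -addrA dvdp_add //.
  by rewrite -opprB dvdpNr.
- by move=> u; exists (rec u); apply: key; rewrite subrr dvdp0.
- move=> P Q; apply: key.
  by rewrite /rec recomposeD opprD addrACA dvdp_add.
- move=> P Q; apply: key.
  rewrite -(subrK (opmul (rec (phi P)) (rec (phi Q))) (opmul P Q)) -addrA.
  rewrite dvdp_add ?opmul_dvdp //.
  by rewrite -opprB dvdpNr; apply: recomposeM.
- split; apply: key; rewrite /rec recompose_delta.
    by rewrite nu0 subrr dvdp0.
  case: ltnP => [_|nu1]; first by rewrite expr1 subrr dvdp0.
  (* Here [nu = 1]: the class of [T] is zero and [M] is itself the modulus. *)
  by rewrite subr0 (_ : nu = 1%N) ?expr1 //; apply/eqP; rewrite eqn_leq nu1.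
Qed.

End DifferentialOperators.

(** * The derivation of the rational function field *)

Lemma fraction_repr (R : idomainType) (x : {fraction R}) :
  x = (\n_(repr x))%:F / (\d_(repr x))%:F.
Proof.
have dF : (\d_(repr x))%:F != 0 by rewrite tofrac_eq0 denom_ratioP.
apply: (mulIf dF); rewrite divfK //.
rewrite -{1}[x]reprK; unlock FracField.tofrac; rewrite -[LHS]FracField.pi_mul.
apply/eqP; rewrite FracField.equivf_def /FracField.mulf.
rewrite !numden_Ratio ?mulr1 ?oner_eq0 ?denom_ratioP //.
by rewrite mulrC.
Qed.

Lemma fraction_div_eq (R : idomainType) (n d n' d' : R) :
  d != 0 -> d' != 0 -> n%:F / d%:F = n'%:F / d'%:F -> n * d' = n' * d.
Proof.
move=> d0 d'0 /eqP; rewrite eqr_div ?tofrac_eq0 // -!tofracM tofrac_eq.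
by move/eqP.
Qed.

Lemma quotient_ruleD (K : fieldType) (a b c d a' b' c' d' : K) :
  b != 0 -> d != 0 ->
  ((a' * d + a * d' + (c' * b + c * b')) * (b * d)
      - (a * d + c * b) * (b' * d + b * d')) / (b * d) ^+ 2
  = (a' * b - a * b') / b ^+ 2 + (c' * d - c * d') / d ^+ 2.
Proof. by move=> b0 d0; field; rewrite ?b0 ?d0. Qed.

Lemma quotient_ruleM (K : fieldType) (a b c d a' b' c' d' : K) :
  b != 0 -> d != 0 ->
  ((a' * c + a * c') * (b * d) - (a * c) * (b' * d + b * d')) / (b * d) ^+ 2
  = (a' * b - a * b') / b ^+ 2 * (c / d) + a / b * ((c' * d - c * d') / d ^+ 2).
Proof. by move=> b0 d0; field; rewrite ?b0 ?d0. Qed.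

Section RationalFunctions.
Variable F : finFieldType.
Implicit Types (x y c : Kt F) (P Q b : {poly Kt F}).

Lemma fraction_ind (S : Kt F -> Prop) :
  (forall n d : {poly F}, d != 0 -> S (n%:F / d%:F)) -> forall x, S x.
Proof. by move=> H x; rewrite (fraction_repr x); apply: H; apply: denom_ratioP. Qed.

(** The quotient rule is independent of the representative picked by [repr]: differentiate the
    cross-multiplied equality of the two fractions. *)
Lemma derK_frac (n d : {poly F}) :
  d != 0 -> derK (n%:F / d%:F) = (n^`() * d - n * d^`())%:F / (d ^+ 2)%:F.
Proof.
move=> d0; rewrite /derK; set r := repr _.
have r0 : \d_r != 0 by apply: denom_ratioP.
have E : \n_r * d = n * \d_r.
  by apply: fraction_div_eq; rewrite // -fraction_repr.
move: (\n_r) (\d_r) r0 E => a b b0 E.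
apply/eqP; rewrite eqr_div ?tofrac_eq0 ?expf_neq0 // -!tofracM tofrac_eq.
have /(congr1 (@deriv _)) := E; rewrite !derivM => E'.
apply/eqP.
transitivity ((a^`() * d + a * d^`()) * b * d - (a * d) * (d^`() * b + b^`() * d)).
  ring.
rewrite E' E; ring.
Qed.

Lemma derKD : {morph @derK F : x y / x + y}.
Proof.
elim/fraction_ind => n d d0; elim/fraction_ind => n' d' d'0.
have [D0 D'0] : d%:F != 0 /\ d'%:F != 0 by rewrite !tofrac_eq0.
rewrite (addf_div _ _ D0 D'0) -!tofracM -tofracD.
rewrite (derK_frac _ (mulf_neq0 d0 d'0)) (derK_frac _ d0) (derK_frac _ d'0).
rewrite !(derivM, derivD) !(tofracB, tofracXn) !(tofracM, tofracD).
by rewrite (quotient_ruleD _ _ _ _ _ _ D0 D'0).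
Qed.

Lemma derKM x y : derK (x * y) = derK x * y + x * derK y.
Proof.
elim/fraction_ind: x => n d d0; elim/fraction_ind: y => n' d' d'0.
have [D0 D'0] : d%:F != 0 /\ d'%:F != 0 by rewrite !tofrac_eq0.
rewrite mulf_div -!tofracM.
rewrite (derK_frac _ (mulf_neq0 d0 d'0)) (derK_frac _ d0) (derK_frac _ d'0).
rewrite !(derivM, derivD) !(tofracB, tofracXn) !(tofracM, tofracD).
by rewrite (quotient_ruleM _ _ _ _ _ _ D0 D'0).
Qed.

Lemma derKB : zmod_morphism (@derK F).
Proof. by move=> x y; apply: (addIr (derK y)); rewrite subrK -derKD subrK. Qed.

HB.instance Definition _ := GRing.isZmodMorphism.Build (Kt F) (Kt F) (@derK F) derKB.

Lemma derK_tofrac (n : {poly F}) : derK n%:F = (n^`())%:F.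
Proof.
rewrite -[n%:F]divr1 -tofrac1 derK_frac ?oner_eq0 //.
by rewrite -polyC1 derivC mulr0 subr0 mulr1 expr1n divr1.
Qed.

(** * The embedding of constants and the [p]-th iterate of the derivation *)

Variable p : nat.
Hypothesis hp : p \in [pchar F].

Let p_gt0 : (0 < p)%N := prime_gt0 (pcharf_prime hp).

Lemma comp_polyXn_eq0 (d : {poly F}) : (d \Po 'X^p == 0) = (d == 0).
Proof. by rewrite comp_poly_eq0 // size_polyXn ltnS. Qed.

Lemma embp_frac (n d : {poly F}) :
  d != 0 -> embp p (n%:F / d%:F) = (n \Po 'X^p)%:F / (d \Po 'X^p)%:F.
Proof.
move=> d0; rewrite /embp; set r := repr _.
have r0 : \d_r != 0 by apply: denom_ratioP.
have E : \n_r * d = n * \d_r.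
  by apply: fraction_div_eq; rewrite // -fraction_repr.
apply/eqP; rewrite eqr_div ?tofrac_eq0 ?comp_polyXn_eq0 // -!tofracM tofrac_eq.
by rewrite -!comp_polyM E.
Qed.

Lemma embpB : zmod_morphism (@embp F p).
Proof.
elim/fraction_ind => n d d0; elim/fraction_ind => n' d' d'0.
have [D0 D'0] : d%:F != 0 /\ d'%:F != 0 by rewrite !tofrac_eq0.
rewrite -mulNr (addf_div _ _ D0 D'0) -tofracN -!tofracM -tofracD.
rewrite (embp_frac _ (mulf_neq0 d0 d'0)) (embp_frac _ d0) (embp_frac _ d'0).
rewrite -mulNr addf_div ?tofrac_eq0 ?comp_polyXn_eq0 //.
by rewrite !(comp_polyM, comp_polyD, raddfN) /= !(tofracM, tofracD, tofracN).
Qed.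

Lemma embpM : monoid_morphism (@embp F p).
Proof.
split.
  by rewrite -[1]divr1 -tofrac1 embp_frac ?oner_eq0 // -polyC1 comp_polyC divr1.
elim/fraction_ind => n d d0; elim/fraction_ind => n' d' d'0.
rewrite mulf_div -!tofracM.
rewrite (embp_frac _ (mulf_neq0 d0 d'0)) (embp_frac _ d0) (embp_frac _ d'0) mulf_div.
by rewrite !comp_polyM -!tofracM.
Qed.

HB.instance Definition _ := GRing.isZmodMorphism.Build (Kt F) (Kt F) (@embp F p) embpB.
HB.instance Definition _ := GRing.isMonoidMorphism.Build (Kt F) (Kt F) (@embp F p) embpM.

Lemma embpX : embp p 'X%:F = 'X%:F ^+ p :> Kt F.
Proof.
rewrite -['X%:F]divr1 -tofrac1 embp_frac ?oner_eq0 // -polyC1 comp_polyC.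
by rewrite comp_polyX divr1 tofracXn /= divr1.
Qed.

Lemma derK_embp x : derK (embp p x) = 0.
Proof.
elim/fraction_ind: x => n d d0.
rewrite embp_frac // derK_frac ?comp_polyXn_eq0 // !deriv_comp derivXn.
have -> : ('X^(p.-1) : {poly F}) *+ p = 0.
  by rewrite -mulr_natr -polyC_natr (pcharf0 hp) polyC0 mulr0.
by rewrite !mulr0 mul0r subrr rmorph0 mul0r.
Qed.

Lemma derKMl x y : derK x = 0 -> derK (x * y) = x * derK y.
Proof. by move=> x0; rewrite derKM x0 mul0r add0r. Qed.

Lemma pchar_Kt : p \in [pchar (Kt F)].
Proof.
rewrite inE (pcharf_prime hp) /= -tofrac1 -rmorphMn tofrac_eq0 -polyC1 -polyCMn.
by rewrite (pcharf0 hp) polyC0.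
Qed.

(** Writing [n / d] as [d^-p] times [n d^(p-1)] makes the denominator a constant; the [p]-th
    derivative of a polynomial is a multiple of [p!], hence zero. *)
Lemma iter_derK_pchar x : iter p (@derK F) x = 0.
Proof.
elim/fraction_ind: x => n d d0; have D0 : d%:F != 0 by rewrite tofrac_eq0.
have -> : n%:F / d%:F = (d%:F ^- p) * (n * d ^+ p.-1)%:F.
  rewrite tofracM tofracXn /= -{1}(prednK p_gt0) exprS invfM mulrACA.
  by rewrite mulVf ?expf_neq0 // mulr1 mulrC.
have c0 : derK (d%:F ^- p) = 0.
  rewrite -exprVn (derivation_exp _ _ derKM) -mulr_natr (pcharf0 pchar_Kt).
  exact: mulr0.
set c := _ ^- p; pose m := n * d ^+ p.-1; rewrite -/m.
have it k : iter k (@derK F) (c * m%:F) = c * (m^`(k))%:F.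
  by elim: k => [//|k IH]; rewrite iterS IH derKMl // derK_tofrac -derivnS.
rewrite it nderivn_def.
have -> : m^`N(p) *+ p`! = 0.
  have/dvdnP[q ->] : (p %| p`!)%N by rewrite dvdn_fact // p_gt0 leqnn.
  by rewrite mulrnA -mulr_natr -polyC_natr (pcharf0 hp) polyC0 mulr0.
by rewrite rmorph0 mulr0.
Qed.

Definition embp_morph : {rmorphism Kt F -> Kt F} := @embp F p.

End RationalFunctions.

(** * The isomorphism over the rational function field *)

Unset Implicit Arguments. Set Strict Implicit.

Theorem mainTheorem4 (F : finFieldType) (p : nat) (hp : p \in [pchar F])
  (N : {poly Kt F}) (nu : nat)
  (hmon : N \is monic) (hirr : irreducible_poly N) (hsep : separable_poly N)
  (hnu : (0 < nu)%N) :
  exists phi : {poly Kt F} -> seq {poly Kt F},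
    ring_iso_quot (cen p (N ^+ nu)) (cen p N) nu phi /\
    tequiv (cen p N) nu (phi (cen p N)) (tT F).
Proof.
pose d : {additive Kt F -> Kt F} := @derK F.
pose emb := embp_morph hp.
pose t : Kt F := FracField.tofrac 'X.
have t0 : t != 0 by rewrite tofrac_eq0 polyX_eq0.
have dt : d t = 1 by rewrite [LHS]derK_tofrac derivX tofrac1.
have dM : forall x y, d (x * y) = d x * y + x * d y by exact: derKM.
have hpK := pchar_Kt hp.
have d_emb : forall x, d (emb x) = 0 by exact: derK_embp.
have iter_d : forall x, iter p d x = 0 by exact: iter_derK_pchar.
(* The element ['X] of [Kt F] serves both as [s], in the source of [emb], and as [t], in its
   target. *)
have emb_t : emb t = t ^+ p by exact: embpX.
have dvdP e P Q : dequiv (cen p e) P Q <-> opcen emb p e %| P - Q.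
  have V := opmul_opcen_dvdp p dM d_emb e (P - Q).
  by split=> [H|/V]; [apply/V|].
have [phi [phi_eqv phi_onto phiD phiM [phi1 phiN]]] :=
  opmul_truncated_iso dM hpK d_emb iter_d t0 dt emb_t hsep hnu.
have nthP P k : (k < nu)%N -> (mkseq (phi P) nu)`_k = phi P k.
  by move=> lt_k; rewrite nth_mkseq.
exists (fun P => mkseq (phi P) nu); split; first split.
- move=> P Q; split=> [/dvdP|H].
    rewrite rmorphXn => /phi_eqv H k lt_k; apply/dvdP; rewrite !nthP //.
    exact: H.
  apply/dvdP; rewrite rmorphXn; apply/phi_eqv => k lt_k.
  by have /dvdP := H k lt_k; rewrite !nthP.
- move=> u; have [P HP] := phi_onto (nth 0 u); exists P => k lt_k.
  by apply/dvdP; rewrite nthP //; apply: HP.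
- move=> P Q k lt_k; apply/dvdP; rewrite nthP // nth_mkseq // !nthP //.
  exact: phiD.
- move=> P Q k lt_k; apply/dvdP; rewrite nthP // nth_mkseq //.
  under eq_bigr => i _ do
    rewrite !nthP ?(leq_ltn_trans (leq_subr _ _) lt_k) ?(leq_ltn_trans (leq_ord i)) //.
  exact: phiM.
- move=> k lt_k; apply/dvdP; rewrite nthP //.
  (* Past the end of the list the default [0] is read, as the delta function requires. *)
  have -> : (tone F)`_k = (k == 0%N)%:R by case: k {lt_k} => [|[]].
  exact: phi1.
- move=> k lt_k; apply/dvdP; rewrite nthP //.
  have -> : (tT F)`_k = (k == 1%N)%:R by case: k {lt_k} => [|[|[]]].
  exact: phiN.
Qed.
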